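(* Let $R$ be a ring. Then the following assertions are equivalent: (1) $R$ is Nil$_{\ast}$-Noetherian; (2) any direct sum of Nil$_{\ast}$-injective $R$-modules is Nil$_{\ast}$-injective; (3) any direct sum of injective $R$-modules is Nil$_{\ast}$-injective; (4) any direct union of Nil$_{\ast}$-injective $R$-modules is Nil$_{\ast}$-injective; (5) any direct union of injective $R$-modules is Nil$_{\ast}$-injective; (6) any Nil$_{\ast}$-FP-injective $R$-module is Nil$_{\ast}$-injective.
   Context: All rings are commutative with identity and all modules are unitary. An ideal $I$ of a ring $R$ is a nil ideal if every element of $I$ is nilpotent. A ring $R$ is Nil$_{\ast}$-Noetherian if every nil ideal of $R$ is finitely generated. An $R$-module $M$ is Nil$_{\ast}$-injective if $\mathrm{Ext}_R^1(R/I,M)=0$ for any nil ideal $I$ of $R$, and Nil$_{\ast}$-FP-injective if $\mathrm{Ext}_R^1(R/I,M)=0$ for any finitely generated nil ideal $I$ of $R$. A direct union of modules is the direct limit of a direct system of modules (over a directed set) in which all the transition maps are inclusion maps. *)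

(* Defs.v *)
From HB Require Import structures.
From mathcomp Require Import all_boot all_algebra.
From mathcomp Require Import boolp classical_sets cardinality.

Set Implicit Arguments.
Unset Strict Implicit.
Unset Printing Implicit Defensive.

Import GRing.Theory.
Local Open Scope quotient_scope.
Local Open Scope classical_set_scope.
Local Open Scope ring_scope.

Section QuotientModule.
Variables (R : pzRingType) (V : lmodType R) (W : submodClosed V).

Lemma submod_zmod_closed : zmod_closed (W : {pred V}).
Proof.
split=> [|x y xW yW]; first exact: rpred0.
by rewrite -scaleN1r rpredD // rpredZ.
Qed.

Definition submod_pred : {pred V} := W.
Definition submod_zmodClosed : zmodClosed V :=
  HB.pack submod_pred
    (GRing.isZmodClosed.Build V submod_pred submod_zmod_closed).

Definition quotmod : Type := Quotient.quot submod_zmodClosed.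

HB.instance Definition _ := GRing.Zmodule.on quotmod.
HB.instance Definition _ := EqQuotient.on quotmod.

Definition quotmod_scale (a : R) (x : quotmod) : quotmod :=
  \pi_quotmod (a *: repr x).

Lemma quotmod_eqP (x y : V) :
  reflect (\pi_quotmod x = \pi_quotmod y) (x - y \in W).
Proof.
rewrite -[x - y \in W]/(x - y \in submod_zmodClosed) Quotient.idealrBE.
exact: eqP.
Qed.

Lemma quotmod_piD (x y : V) :
  \pi_quotmod (x + y) = \pi_quotmod x + \pi_quotmod y.
Proof. exact: (Quotient.pi_add submod_zmodClosed). Qed.

Lemma quotmod_piZ a (x : V) :
  \pi_quotmod (a *: x) = quotmod_scale a (\pi_quotmod x).
Proof.
apply/quotmod_eqP; rewrite -scalerBr rpredZ //.
by apply/quotmod_eqP; rewrite reprK.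
Qed.

Lemma quotmod_scalerA a b x :
  quotmod_scale a (quotmod_scale b x) = quotmod_scale (a * b) x.
Proof. by rewrite -[x]reprK -!quotmod_piZ scalerA reprK. Qed.

Lemma quotmod_scale1r : left_id 1 quotmod_scale.
Proof. by move=> x; rewrite -[x]reprK -quotmod_piZ scale1r. Qed.

Lemma quotmod_scalerDr : right_distributive quotmod_scale +%R.
Proof.
move=> a x y; rewrite -[x]reprK -[y]reprK -quotmod_piD -!quotmod_piZ.
by rewrite -quotmod_piD scalerDr.
Qed.

Lemma quotmod_scalerDl x : {morph quotmod_scale^~ x : a b / a + b}.
Proof.
by move=> a b; rewrite -[x]reprK -!quotmod_piZ -quotmod_piD scalerDl.
Qed.

HB.instance Definition _ := GRing.Zmodule_isLmodule.Build R quotmod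
  quotmod_scalerA quotmod_scale1r quotmod_scalerDr quotmod_scalerDl.

End QuotientModule.

Section DirectSum.
Variables (R : pzRingType) (J : Type) (M : J -> lmodType R).

Definition prodmod : Type := forall j, M j.
HB.instance Definition _ := Choice.on prodmod.
Implicit Types f g h : prodmod.

Definition prodmod_zero : prodmod := fun=> 0.
Definition prodmod_opp f : prodmod := fun j => - f j.
Definition prodmod_add f g : prodmod := fun j => f j + g j.
Definition prodmod_scale (a : R) f : prodmod := fun j => a *: f j.

Lemma prodmod_addA : associative prodmod_add.
Proof. by move=> f g h; apply: functional_extensionality_dep => j; apply: addrA. Qed.
Lemma prodmod_addC : commutative prodmod_add.
Proof. by move=> f g; apply: functional_extensionality_dep => j; apply: addrC. Qed.
Lemma prodmod_add0 : left_id prodmod_zero prodmod_add.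
Proof. by move=> f; apply: functional_extensionality_dep => j; apply: add0r. Qed.
Lemma prodmod_addN : left_inverse prodmod_zero prodmod_opp prodmod_add.
Proof. by move=> f; apply: functional_extensionality_dep => j; apply: addNr. Qed.

HB.instance Definition _ := GRing.isZmodule.Build prodmod
  prodmod_addA prodmod_addC prodmod_add0 prodmod_addN.

Lemma prodmod_scalerA a b f :
  prodmod_scale a (prodmod_scale b f) = prodmod_scale (a * b) f.
Proof. by apply: functional_extensionality_dep => j; apply: scalerA. Qed.
Lemma prodmod_scale1r : left_id 1 prodmod_scale.
Proof. by move=> f; apply: functional_extensionality_dep => j; apply: scale1r. Qed.
Lemma prodmod_scalerDr : right_distributive prodmod_scale +%R.
Proof. by move=> a f g; apply: functional_extensionality_dep => j; apply: scalerDr. Qed.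
Lemma prodmod_scalerDl f : {morph prodmod_scale^~ f : a b / a + b}.
Proof. by move=> a b; apply: functional_extensionality_dep => j; apply: scalerDl. Qed.

HB.instance Definition _ := GRing.Zmodule_isLmodule.Build R prodmod
  prodmod_scalerA prodmod_scale1r prodmod_scalerDr prodmod_scalerDl.

Definition fin_supp : {pred prodmod} :=
  fun f => `[< finite_set [set j | f j != 0] >].

Lemma fin_supp_submod_closed : submod_closed fin_supp.
Proof.
split=> [|a f g /asboolP fs /asboolP gs]; apply/asboolP.
  apply: (sub_finite_set _ (finite_set0 J)) => j /=.
  by rewrite eqxx.
have := conj fs gs; rewrite -finite_setU; apply: sub_finite_set => j /=.
move=> fg; case: (eqVneq (f j) 0) => f0; [right|by left].
apply: contraNneq fg => g0.
by rewrite -[X in X == 0]/(a *: f j + g j) f0 g0 scaler0 addr0.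
Qed.

HB.instance Definition _ :=
  GRing.isSubmodClosed.Build R prodmod fin_supp fin_supp_submod_closed.

Record dsum : Type := DSum { dsum_val :> prodmod; _ : dsum_val \in fin_supp }.

HB.instance Definition _ := [isSub for dsum_val].
HB.instance Definition _ := [Choice of dsum by <:].
HB.instance Definition _ := [SubChoice_isSubLmodule of dsum by <:].

End DirectSum.

Section HomologicalNotions.
Variable R : pzRingType.

Definition is_projective (P : lmodType R) : Prop :=
  forall (A B : lmodType R) (p : {linear A -> B}) (f : {linear P -> B}),
    (forall b, exists a, p a = b) ->
    exists g : {linear P -> A}, forall x, p (g x) = f x.

Definition is_injective (E : lmodType R) : Prop :=
  forall (A B : lmodType R) (i : {linear A -> B}) (f : {linear A -> E}),
    injective i ->
    exists g : {linear B -> E}, forall x, g (i x) = f x.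

Record projective_resolution (N : lmodType R) := ProjectiveResolution {
  res_obj :> nat -> lmodType R;
  res_d : forall n, {linear res_obj n.+1 -> res_obj n};
  res_aug : {linear res_obj 0 -> N};
  res_projective : forall n, is_projective (res_obj n);
  res_aug_surj : forall y, exists x, res_aug x = y;
  res_exact0 : forall x, res_aug x = 0 <-> exists y, res_d 0 y = x;
  res_exact : forall n x, res_d n x = 0 <-> exists y, res_d n.+1 y = x
}.

(* Ext^1_R(N, M) = 0 : for a projective resolution P of N, the complex
   Hom(P 0, M) -> Hom(P 1, M) -> Hom(P 2, M) is exact at Hom(P 1, M). *)
Definition Ext1_eq0 (N M : lmodType R) : Prop :=
  forall (P : projective_resolution N) (f : {linear P 1 -> M}),
    (forall x, f (res_d P 1 x) = 0) ->
    exists g : {linear P 0 -> M}, forall x, f x = g (res_d P 0 x).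

Definition fin_gen (V : lmodType R) (W : submodClosed V) : Prop :=
  exists (n : nat) (w : 'I_n -> V), forall x,
    x \in W <-> exists c : 'I_n -> R, x = \sum_(i < n) c i *: w i.

Definition directed (J : Type) (le : J -> J -> Prop) : Prop :=
  [/\ inhabited J,
      forall i, le i i,
      forall i j k, le i j -> le j k -> le i k &
      forall i j, exists2 k, le i k & le j k].

Record direct_system (J : Type) (le : J -> J -> Prop) := DirectSystem {
  ds_obj :> J -> lmodType R;
  ds_map : forall i j, le i j -> {linear ds_obj i -> ds_obj j};
  ds_id : forall i (ii : le i i) x, ds_map ii x = x;
  ds_comp : forall i j k (ij : le i j) (jk : le j k) (ik : le i k) x,
    ds_map jk (ds_map ij x) = ds_map ik x
}.

Section DirectLimit.
Variables (J : Type) (le : J -> J -> Prop) (D : direct_system le).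

Definition is_cocone (T : lmodType R) (v : forall j, {linear D j -> T}) : Prop :=
  forall i j (ij : le i j) x, v j (ds_map D ij x) = v i x.

Definition is_direct_limit (L : lmodType R) (u : forall j, {linear D j -> L}) :
    Prop :=
  is_cocone u /\
  forall (T : lmodType R) (v : forall j, {linear D j -> T}), is_cocone v ->
    exists h : {linear L -> T},
      (forall j x, h (u j x) = v j x) /\
      (forall h' : {linear L -> T},
         (forall j x, h' (u j x) = v j x) -> forall y, h' y = h y).

(* The transition maps are inclusions up to identifying each module with its
   image, that is, they are injective. *)
Definition is_direct_union (L : lmodType R) : Prop :=
  [/\ directed le,
      forall i j (ij : le i j), injective (ds_map D ij) &
      exists u : forall j, {linear D j -> L}, is_direct_limit u].

End DirectLimit.
End HomologicalNotions.

Section NilNotions.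
Variable R : comPzRingType.

(* Ideals of R are the submodules of the regular module R^o; unlike [idealr],
   this includes the unit ideal, and [comPzRingType] includes the zero ring. *)
Definition nil_ideal (I : submodClosed R^o) : Prop :=
  forall x : R, x \in I -> exists n : nat, x ^+ n = 0.

Definition Nil_Noetherian : Prop :=
  forall I : submodClosed R^o, nil_ideal I -> fin_gen I.

Definition Nil_injective (M : lmodType R) : Prop :=
  forall I : submodClosed R^o, nil_ideal I -> Ext1_eq0 (quotmod I) M.

Definition Nil_FP_injective (M : lmodType R) : Prop :=
  forall I : submodClosed R^o, nil_ideal I -> fin_gen I ->
    Ext1_eq0 (quotmod I) M.

End NilNotions.

(* Main.v *)
Require Import Defs.
From HB Require Import structures.
From mathcomp Require Import all_boot all_algebra finmap.
From mathcomp Require Import boolp classical_sets functions fsbigop cardinality.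

Set Implicit Arguments.
Unset Strict Implicit.
Unset Printing Implicit Defensive.

Import GRing.Theory Num.Theory.
Local Open Scope quotient_scope.
Local Open Scope classical_set_scope.
Local Open Scope ring_scope.

(** The vanishing of Ext^1(R/I, M) is turned into an elementary extension
property, called [extendable I M] below: every R-linear map I -> M is
multiplication by some m in M. This is [extendable_Ext1] and
[Ext1_extendable]; the second needs an actual projective resolution of R/I
starting with R, which is assembled from free modules.

If I is finitely generated, a linear map from I into a direct sum has its
image in finitely many summands, so the summands may be treated one by one
([dsum_extendable]); and a linear map from I into a direct union has its image
in one of the members ([direct_union_extendable]). Hence over a
Nil_*-Noetherian ring direct sums and direct unions inherit
Nil_*-injectivity, and over any ring direct sums of injectives are
Nil_*-FP-injective.

Conversely, let direct sums of injectives be Nil_*-injective. The argument is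
that of Bass. A nil ideal which is not finitely generated contains a strictly
increasing chain of ideals W_n with elements x_n in W_(n+1) but not in W_n.
The module C = Hom_Z(R, Q/Z) is injective, and some additive character
chi_n : R -> Q/Z, that is some element of C, vanishes on W_n but not at x_n. On
the union I' of the W_n, y |-> (y chi_n)_n takes values in the direct sum of
countably many copies of C: if y is in W_k then y chi_n = 0 for n >= k. An
extension to R would be multiplication by a family m of finite support; at an
index N with m_N = 0 this gives x_N chi_N = 0, whereas its value at 1 is
chi_N(x_N) <> 0. This is [fin_gen_of_dsum_extendable].

A direct sum of injectives is the direct union of its submodules of elements
supported in a given finite set of indices, and each of these is a retract of
the full product, hence injective ([dsum_injective_union]). So the statements
on direct unions imply those on direct sums. Finally, if Nil_*-FP-injective
modules are Nil_*-injective, then direct sums of injectives are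
Nil_*-injective, and the argument of Bass applies again. *)

(** * Submodules and bundled linear maps *)

Section Submodules.
Variables (R : pzRingType) (V : lmodType R).

Definition prop_pred (P : set V) : {pred V} := fun x => `[< P x >].

Lemma prop_submod_closed (P : set V) : P 0 ->
    (forall a x y, P x -> P y -> P (a *: x + y)) ->
  submod_closed (prop_pred P).
Proof.
move=> P0 PD; split=> [|a x y]; first exact/asboolP.
by move=> /asboolP Px /asboolP Py; apply/asboolP/PD.
Qed.

Lemma submod_of_prop (P : set V) : P 0 ->
    (forall a x y, P x -> P y -> P (a *: x + y)) ->
  exists W : submodClosed V, forall x, (x \in W) <-> P x.
Proof.
move=> P0 PD.
exists (HB.pack_for (submodClosed V) (prop_pred P)
  (GRing.isSubmodClosed.Build R V _ (prop_submod_closed P0 PD))) => x.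
by split=> /asboolP.
Qed.

Definition mklin (W : lmodType R) (f : V -> W) (fL : linear f) :
    {linear V -> W} :=
  HB.pack f (GRing.isLinear.Build R V W *:%R f fL).

Record subm (W : submodClosed V) : Type :=
  Subm { subm_val :> V; _ : subm_val \in W }.

End Submodules.

Section SubmLmod.
Variables (R : pzRingType) (V : lmodType R) (W : submodClosed V).
HB.instance Definition _ := [isSub of subm W for @subm_val R V W].
HB.instance Definition _ := [Choice of subm W by <:].
HB.instance Definition _ := [SubChoice_isSubLmodule of subm W by <:].
End SubmLmod.

(** * Free modules *)

Section FreeModules.
Variable R : pzRingType.

(** The free module on X is the direct sum of copies of R indexed by X. The
first clause, that the basis e spans, replaces uniqueness of the maps given by
the universal property: two linear maps that agree on the basis agree because
the kernel of their difference contains it. *)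
Lemma free_module_exists (X : Type) :
  exists (F : lmodType R) (e : X -> F),
    (forall P : submodClosed F, (forall x, e x \in P) -> forall f, f \in P) /\
    (forall (N : lmodType R) (h : X -> N),
       exists H : {linear F -> N}, forall x, H (e x) = h x).
Proof.
elim/Pchoice: X => X.
pose M (_ : X) : lmodType R := R^o.
pose F : lmodType R := dsum M.
pose d (x : X) : prodmod M := fun y => (y == x)%:R.
have dP x : d x \in @fin_supp R X M.
  apply/asboolP; apply: (sub_finite_set _ (finite_set1 x)) => y /=.
  by apply: contra_neqP => /eqP/negPf yx; rewrite /d yx.
pose e x : F := DSum (dP x).
pose v (f : F) (x : X) : R := dsum_val f x.
have vL a f g x : v (a *: f + g) x = a * v f x + v g x by [].
have vP f g : v f =1 v g -> f = g.
  by move=> fg; apply/val_inj/functional_extensionality_dep/fg.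
have ve x y : v (e x) y = (y == x)%:R by [].
have suppP (f : F) : finite_set [set j | v f j != 0].
  by rewrite /v; case: f => f /= /asboolP.
clearbody v e.
(* The map induced by h; supports being finite, it may be computed over any
   finite set containing the support. *)
pose H (N : lmodType R) (h : X -> N) (f : F) : N :=
  \sum_(x \in [set: X]) v f x *: h x.
have HE N h (A : {fset X}) (f : F) : (forall x, x \notin A -> v f x = 0) ->
    H N h f = \sum_(x <- A) v f x *: h x.
  by move=> fA; apply: fsbigTE => j /fA ->; rewrite scale0r.
have HL N h : linear (H N h).
  move=> a f g.
  pose A := fset_set ([set j | v f j != 0] `|` [set j | v g j != 0]).
  have inA k : k \notin A -> v f k = 0 /\ v g k = 0.
    rewrite in_fset_set ?finite_setU; last by split; apply: suppP.
    move=> /negP kA; split; apply: contra_notP kA => /eqP k0; apply/mem_set.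
      by left.
    by right.
  rewrite !(HE _ _ A); first last.
  - move=> j /inA[fj gj].
    by rewrite vL fj gj mulr0 addr0.
  - by move=> j /inA[].
  - by move=> j /inA[].
  rewrite scaler_sumr -big_split /=; apply: eq_bigr => j _.
  by rewrite vL scalerA -scalerDl.
exists F, e; split=> [P eP f|N h].
  have -> : f = H F e f; last first.
    by rewrite /H; apply: rpred_sum => x _; rewrite rpredZ.
  apply: vP => x.
  pose A := fset_set [set j | v f j != 0].
  have inA k : k \notin A -> v f k = 0.
    rewrite in_fset_set; last exact: suppP.
    by move=> /negP kA; apply: contra_notP kA => /eqP k0; apply/mem_set.
  rewrite (HE _ _ A) //.
  have v0 : v 0 x = 0.
    by have := vL (-1) 0 0 x; rewrite scaler0 addr0 mulN1r addNr.
  have vD : {morph v^~ x : f g / f + g}.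
    by move=> f1 f2; have := vL 1 f1 f2 x; rewrite scale1r mul1r.
  have vZ a g : v (a *: g) x = a * v g x by rewrite -[a *: g]addr0 vL v0 addr0.
  rewrite (big_morph (v^~ x) vD v0).
  have [xA|/inA fx] := boolP (x \in A).
    rewrite (big_fsetD1 x) //= big1_seq ?addr0.
      by rewrite vZ ve eqxx mulr1.
    move=> y /=; rewrite !inE => /andP[yx _].
    by rewrite vZ ve eq_sym (negPf yx) mulr0.
  rewrite big1_seq // => y _ /=; rewrite vZ ve.
  by case: eqVneq => [<-|]; rewrite ?mulr0 // fx mul0r.
exists (mklin (HL N h)) => x; rewrite -[LHS]/(H N h (e x)).
rewrite (HE _ _ [fset x]%fset).
  by rewrite big_seq_fset1 ve eqxx scale1r.
move=> y; rewrite inE => /negPf yx.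
by rewrite ve yx.
Qed.

End FreeModules.

(** * Projective resolutions *)

Section Resolutions.
Variable R : pzRingType.

Lemma regular_projective : is_projective (R^o : lmodType R).
Proof.
move=> A B p f p_surj; have [a pa] := p_surj (f 1).
have gL : linear (fun r : R^o => (r : R) *: a).
  by move=> r x y; rewrite scalerDl -scalerA.
exists (mklin gL) => r; rewrite -[mklin gL r]/((r : R) *: a) linearZ /= pa.
by rewrite -linearZ /= -[_ *: _]/(_ * _) mulr1.
Qed.

Lemma ker_submod (A B : lmodType R) (d : {linear A -> B}) :
  exists W : submodClosed A, forall x, (x \in W) <-> d x = 0.
Proof.
apply: submod_of_prop => [|a x y dx dy]; first exact: linear0.
by rewrite linearP dx dy scaler0 addr0.
Qed.

(** The inductive step of a resolution: the free module on the set of elements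
killed by d maps onto the kernel of d. *)
Lemma kernel_cover (A B : lmodType R) (d : {linear A -> B}) :
  exists (F : lmodType R) (c : {linear F -> A}),
    is_projective F /\ forall x, d x = 0 <-> exists y, c y = x.
Proof.
have [F [e [e_span e_univ]]] := free_module_exists R {x : A | d x = 0}.
have [c cE] := e_univ A (@proj1_sig _ _).
exists F, c; split=> [A' B' p f p_surj|x].
  have [a pa] := choice (fun x => p_surj (f (e x))).
  have [g gE] := e_univ A' a.
  have dL : linear (fun x => p (g x) - f x).
    by move=> r x y; rewrite !linearP addrACA -scalerDr.
  have [W WE] := ker_submod (mklin dL).
  exists g => x; apply/eqP; rewrite -subr_eq0; apply/eqP.
  by apply/(WE x)/e_span => z; apply/WE/eqP; rewrite /= gE pa subrr.
split=> [dx|[y <-]]; first by exists (e (exist _ x dx)); rewrite cE.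
have [W WE] := ker_submod d.
have cdL : linear (fun y => d (c y)) by move=> r u v; rewrite !linearP.
have [W' W'E] := ker_submod (mklin cdL).
by apply/(W'E y)/e_span => -[z dz]; apply/W'E; rewrite /= cE.
Qed.

Definition cover_obj (A B : lmodType R) (d : {linear A -> B}) : lmodType R :=
  sval (cid (kernel_cover d)).

Definition cover_map (A B : lmodType R) (d : {linear A -> B}) :
    {linear cover_obj d -> A} :=
  sval (cid (svalP (cid (kernel_cover d)))).

Lemma cover_mapP (A B : lmodType R) (d : {linear A -> B}) :
  is_projective (cover_obj d) /\
  forall x, d x = 0 <-> exists y, cover_map d y = x.
Proof. exact: svalP (cid (svalP (cid (kernel_cover d)))). Qed.

(** The differentials of a resolution are built by recursion, each from the one
before it. Carrying the two ends of a map along with it makes the source of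
each differential definitionally the target of the next, so that no casts are
needed. *)
Record arrow : Type := Arrow {
  arrow_src : lmodType R;
  arrow_tgt : lmodType R;
  arrow_map :> {linear arrow_src -> arrow_tgt}
}.

Section ResolutionOf.
Variables (P N : lmodType R) (aug : {linear P -> N}).
Hypothesis P_proj : is_projective P.
Hypothesis aug_surj : forall y, exists x, aug x = y.

Fixpoint differential n : arrow :=
  if n is m.+1 then Arrow (cover_map (differential m))
  else Arrow (cover_map aug).

Lemma differential_projective n : is_projective (arrow_tgt (differential n)).
Proof. by case: n => [|[|n]] //; apply: (cover_mapP _).1. Qed.

Definition resolution_of : projective_resolution N :=
  @ProjectiveResolution R N (fun n => arrow_tgt (differential n))
    (fun n => differential n) aug differential_projective aug_surj
    (cover_mapP aug).2 (fun n => (cover_mapP (differential n)).2).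

End ResolutionOf.

Lemma quotmod_pi_linear (V : lmodType R) (W : submodClosed V) :
  linear (fun x : V => \pi_(quotmod W) x).
Proof. by move=> a x y; rewrite quotmod_piD quotmod_piZ. Qed.

Lemma quotmod_pi_eq0 (V : lmodType R) (W : submodClosed V) (x : V) :
  \pi_(quotmod W) x = 0 <-> x \in W.
Proof.
rewrite -(linear0 (mklin (quotmod_pi_linear W))) /=.
by have := quotmod_eqP W x 0; rewrite subr0 => E; split=> /E.
Qed.

Lemma quotmod_pi_surj (V : lmodType R) (W : submodClosed V) (y : quotmod W) :
  exists x, mklin (quotmod_pi_linear W) x = y.
Proof. by exists (repr y); rewrite /= reprK. Qed.

End Resolutions.

(** * Vanishing of Ext^1 as an extension property *)

Section Extendable.
Variables (R : pzRingType).

(** Maps out of an ideal are encoded as functions on the whole ring that are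
linear on the ideal, so that ideals need not be made into types. *)
Definition linear_on (I : submodClosed R^o) (M : lmodType R) (f : R -> M) :=
  forall a x y : R, x \in I -> y \in I -> f (a * x + y) = a *: f x + f y.

Definition extendable (I : submodClosed R^o) (M : lmodType R) :=
  forall f : R -> M, linear_on I f ->
    exists m, forall x : R, x \in I -> f x = x *: m.

Lemma linear_on0 I (M : lmodType R) (f : R -> M) : linear_on I f -> f 0 = 0.
Proof.
move=> fI; have := fI 1 0 0 (rpred0 I) (rpred0 I).
by rewrite mulr0 addr0 scale1r => /eqP; rewrite addrC -subr_eq subrr => /eqP.
Qed.

(** Let P be a resolution of R/I with augmentation aug, and f a 1-cocycle. It
induces a map f' on K = ker aug. Lifting R -> R/I to P_0 (1 |-> p0) and aug to
al : P_0 -> R gives x - al(x) p0 in K for all x, and r p0 in K for r in I. If m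
extends r |-> f'(r p0), then x |-> f'(x - al(x) p0) + al(x) m extends f'. *)
Lemma extendable_Ext1 I (M : lmodType R) :
  extendable I M -> Ext1_eq0 (quotmod I) M.
Proof.
move=> extI P f fd; pose d := res_d P 0; pose aug := res_aug P.
have [p0 aug_p0] := res_aug_surj P (\pi_(quotmod I) (1 : R^o)).
have augZ (r : R) : aug (r *: p0) = \pi_(quotmod I) (r : R^o).
  by rewrite linearZ /= aug_p0 -[LHS]quotmod_piZ -[_ *: _]/(_ * _) mulr1.
have [al alE] := @res_projective _ _ P 0 _ _ _ aug (@quotmod_pi_surj R _ I).
have fE y z : d y = d z -> f y = f z.
  move=> dyz; apply/eqP; rewrite -subr_eq0 -linearB /=; apply/eqP.
  have /res_exact[w <-] : d (y - z) = 0 by rewrite linearB /= dyz subrr.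
  exact: fd.
have [f' f'd] : exists f' : P 0 -> M, forall y, f' (d y) = f y.
  have /choice[f' f'P] : forall x, exists m, forall y, d y = x -> m = f y.
    move=> x; have [[y dy]|Nx] := pselect (exists y, d y = x).
      by exists (f y) => z dz; apply: fE; rewrite dy dz.
    by exists 0 => y dy; case: Nx; exists y.
  by exists f' => y; rewrite (f'P _ y).
have f'L a x y : aug x = 0 -> aug y = 0 -> f' (a *: x + y) = a *: f' x + f' y.
  move=> /res_exact0[u <-] /res_exact0[v <-].
  by rewrite -linearP !f'd linearP.
have [|m mE] := extI (fun r => f' (r *: p0)).
  move=> a x y xI yI; rewrite scalerDl -scalerA f'L // augZ;
  exact/quotmod_pi_eq0.
have alP x : aug (x - (al x : R) *: p0) = 0.
  by rewrite linearB /= augZ -(alE x) /= subrr.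
have gL : linear (fun x => f' (x - (al x : R) *: p0) + (al x : R) *: m).
  move=> a x y.
  have alL : (al (a *: x + y) : R) = a * al x + al y by rewrite linearP.
  rewrite alL !scalerDl -!scalerA.
  rewrite [X in f' X](_ : _ =
      a *: (x - (al x : R) *: p0) + (y - (al y : R) *: p0)).
    by rewrite f'L // scalerDr addrACA.
  by rewrite opprD scalerBr addrACA.
exists (mklin gL) => y /=; rewrite -/d.
have augd : aug (d y) = 0 by apply/res_exact0; exists y.
have alI : al (d y) \in I by apply/quotmod_pi_eq0; rewrite -augd; exact: alE.
rewrite -(mE _ alI) addrC -[X in _ + X]scale1r -[RHS]addrC.
rewrite -f'L ?scale1r ?subrK ?f'd ?augZ //; exact/quotmod_pi_eq0.
Qed.

(** In a resolution that starts with R -> R/I, the first differential d has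
image I, so f o d is a cocycle, and writing it as a coboundary extends f. *)
Lemma Ext1_extendable I (M : lmodType R) :
  Ext1_eq0 (quotmod I) M -> extendable I M.
Proof.
move=> ext0 f fI.
pose Q := resolution_of (@regular_projective R) (@quotmod_pi_surj R _ I).
pose d : {linear Q 1%N -> R^o} := res_d Q 0.
have dI y : d y \in I.
  by apply/quotmod_pi_eq0/(@res_exact0 _ _ Q (d y)); exists y.
have fdL : linear (fun y : Q 1%N => f (d y)).
  by move=> a x y; rewrite linearP /= fI.
have [|g gE] := ext0 Q (mklin fdL).
  move=> x /=; have -> : d (res_d Q 1 x) = 0.
    by apply/(@res_exact _ _ Q 0); exists x.
  exact: linear_on0 fI.
exists (g (1 : R^o)) => x /quotmod_pi_eq0/(@res_exact0 _ _ Q x)[y dy].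
rewrite -dy; have /= -> := gE y; rewrite -/d -linearZ /=; congr (g _).
by rewrite -[RHS]/(_ * _) mulr1.
Qed.

End Extendable.

(** * Finitely generated ideals and direct sums *)

Section FinitelyGenerated.
Variables (R : pzRingType) (I : submodClosed R^o).
Hypothesis I_fg : fin_gen I.

(** The generators w do not depend on M: the finitely many values at w decide
in which submodule the image of I lies. *)
Lemma linear_on_fin_gen : exists (n : nat) (w : 'I_n -> R),
  (forall i, w i \in I) /\
  forall (M : lmodType R) (P : submodClosed M) (f : R -> M), linear_on I f ->
    (forall i, f (w i) \in P) -> forall x : R, x \in I -> f x \in P.
Proof.
have [n [w wE]] := I_fg.
have wI i : w i \in I.
  apply/wE; exists (fun j => (j == i)%:R).
  rewrite (bigD1 i) //= eqxx scale1r big1 ?addr0 // => j /negPf ->.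
  by rewrite scale0r.
exists n, w; split=> // M P f fI fwP x /wE[c ->].
suff [] : (\sum_(i < n) c i *: w i \in I) /\
    f (\sum_(i < n) c i *: w i) \in P by [].
apply: (big_rec (fun x : R => ((x : R^o) \in I) /\ f x \in P)).
  by rewrite (linear_on0 fI) !rpred0.
move=> i y _ [yI fyP]; split; first by rewrite rpredD ?rpredZ.
by rewrite fI // rpredD ?rpredZ.
Qed.

(** Each component extends separately; the extensions may be set to 0 outside
the finitely many indices met by the values at the generators. *)
Lemma dsum_extendable (J : Type) (M : J -> lmodType R) :
  (forall j, extendable I (M j)) -> extendable I (dsum M).
Proof.
move=> extM f fI; have [n [w [wI w_gen]]] := linear_on_fin_gen.
have [m mE] : exists m : forall j, M j,
    forall j (x : R), x \in I -> dsum_val (f x) j = x *: m j.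
  have mj j : exists mj : M j,
      forall x : R, x \in I -> dsum_val (f x) j = x *: mj.
    by apply: extM => a x y xI yI; rewrite fI.
  by exists (fun j => sval (cid (mj j))) => j; apply: svalP (cid (mj j)).
pose F : set J :=
  \bigcup_(i in [set: 'I_n]) [set j | dsum_val (f (w i)) j != 0].
have F_fin : finite_set F.
  by apply: bigcup_finite => // i _; case: (f (w i)) => g /= /asboolP.
pose g : prodmod M := fun j => if pselect (F j) then m j else 0.
have gP : g \in @fin_supp R J M.
  apply/asboolP; apply: (sub_finite_set _ F_fin) => j /= /eqP.
  by apply: contra_notP => Fj; rewrite /g; case: pselect.
exists (DSum gP) => x xI; apply/val_inj/functional_extensionality_dep => j /=.
rewrite -[RHS]/(x *: g j) /g; case: pselect => [Fj|Fj] /=; first exact: mE.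
have [W WE] : exists W : submodClosed (dsum M),
    forall h, (h \in W) <-> dsum_val h j = 0.
  apply: submod_of_prop => // a h1 h2 h10 h20.
  by rewrite -[LHS]/(a *: dsum_val h1 j + dsum_val h2 j) h10 h20 scaler0 addr0.
rewrite scaler0; apply/WE/w_gen => // i; apply/WE/eqP.
by apply: contra_notT Fj => fwj; exists i.
Qed.

End FinitelyGenerated.

(** * Finitely generated ideals and direct unions *)

Section DirectUnion.
Variables (R : pzRingType) (J : Type) (le : J -> J -> Prop).
Variables (D : direct_system R le) (L : lmodType R).

Lemma directed_bound : directed le ->
  forall n (j : 'I_n -> J), exists k, forall i, le (j i) k.
Proof.
move=> [[j0] _ le_trans le_dir]; elim=> [|n IHn] j.
  by exists j0 => -[].
have [k jk] := IHn (fun i => j (lift ord0 i)).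
have [l kl jl] := le_dir k (j ord0).
exists l => i; case: (unliftP ord0 i) => [i' ->|-> //].
exact: le_trans (jk i') kl.
Qed.

(** The union W of the images is a submodule, and the projection L -> L/W and
the zero map agree on all the images; by uniqueness they are equal. *)
Lemma direct_limit_cover (u : forall j, {linear D j -> L}) :
  directed le -> is_direct_limit u -> forall y, exists j x, u j x = y.
Proof.
move=> [[j0] _ _ le_dir] [uC u_univ].
have [|a _ _ [i [x <-]] [j [y <-]]|W WE] :=
    @submod_of_prop R L [set y | exists j x, u j x = y].
- by exists j0, 0; rewrite linear0.
- have [k ik jk] := le_dir i j.
  exists k, (a *: ds_map D ik x + ds_map D jk y).
  by rewrite linearP /= !uC.
have zL V : linear (fun _ : V : lmodType R => 0 : quotmod W).
  by move=> a x y; rewrite scaler0 addr0.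
have [|h [_ h_uniq]] := u_univ _ (fun j => mklin (@zL (D j))); first by [].
move=> y; apply/(WE y)/quotmod_pi_eq0.
have /= -> := h_uniq (mklin (quotmod_pi_linear W)) _ y.
  by rewrite -(h_uniq (mklin (@zL L))).
by move=> j x /=; apply/quotmod_pi_eq0/WE; exists j, x.
Qed.

(** The universal property is tested on an explicit cocone with injective
legs: the product of all the D_k modulo the families that vanish from some
index on, where x in D_j goes to its images in the D_k with j <= k, and to 0 at
the other indices. *)
Lemma direct_limit_injective (u : forall j, {linear D j -> L}) :
  directed le -> (forall i j (ij : le i j), injective (ds_map D ij)) ->
  is_direct_limit u -> forall j, injective (u j).
Proof.
move=> [[j0] le_refl le_trans le_dir] D_inj [uC u_univ].
have [||W WE] := @submod_of_prop R (prodmod D)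
    [set f | exists k0, forall k, le k0 k -> f k = 0].
- by exists j0.
- move=> a f g [k fk] [l gl]; have [n kn ln] := le_dir k l.
  exists n => p np; rewrite -[LHS]/(a *: f p + g p) fk ?gl ?scaler0 ?addr0 //.
    exact: le_trans ln np.
  exact: le_trans kn np.
pose v j (x : D j) : prodmod D := fun k =>
  if pselect (le j k) is left jk then ds_map D jk x else 0.
have vE j k (jk : le j k) x : v j x k = ds_map D jk x.
  by rewrite /v; case: pselect => // jk'; rewrite (Prop_irrelevance jk' jk).
have vL j : linear (v j).
  move=> a x y; apply: functional_extensionality_dep => k.
  rewrite -[RHS]/(a *: v j x k + v j y k) /v.
  by case: pselect => [jk|_]; rewrite ?linearP // scaler0 addr0.
have pvL j : linear (fun x => \pi_(quotmod W) (v j x)).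
  by move=> a x y; rewrite vL quotmod_pi_linear.
have [|h [hE _]] := u_univ _ (fun j => mklin (pvL j)).
  move=> i j ij x /=; apply/quotmod_eqP/WE; exists j => k jk.
  rewrite -[LHS]/(v j _ k - v i x k) vE (vE i k (le_trans _ _ _ ij jk)).
  by rewrite (ds_comp _ _ (le_trans _ _ _ ij jk)) subrr.
move=> j; apply: raddf_inj => x ux0.
have /quotmod_pi_eq0/WE[k0 vk0] : \pi_(quotmod W) (v j x) = 0.
  by have := hE j x; rewrite ux0 linear0 /= => <-.
have [k jk k0k] := le_dir j k0.
by apply: (D_inj j k jk); rewrite linear0 -vE; apply: vk0.
Qed.

(** The generators are sent into a common member D_k; as D_k -> L is injective,
the map on I lifts to D_k as a linear map. *)
Lemma direct_union_extendable (I : submodClosed R^o) : fin_gen I ->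
  is_direct_union D L -> (forall j, extendable I (D j)) -> extendable I L.
Proof.
move=> I_fg [le_dir D_inj [u uL]] extD f fI.
have [n [w [wI w_gen]]] := linear_on_fin_gen I_fg.
have u_cover := direct_limit_cover le_dir uL.
have u_inj := direct_limit_injective le_dir D_inj uL.
have [j jP] := choice (fun i => u_cover (f (w i))).
have [k jk] := directed_bound le_dir j.
have [|a _ _ [x <-] [y <-]|W WE] :=
    @submod_of_prop R L [set y | exists x, u k x = y].
- by exists 0; rewrite linear0.
- by exists (a *: x + y); rewrite linearP.
have /choice[g gE] : forall x : R, exists y, x \in I -> u k y = f x.
  move=> x; have [xI|] := boolP ((x : R^o) \in I); last by exists 0.
  have /WE[y uy] : f x \in W; last by exists y.
  apply: w_gen => // i; apply/WE; have [y uy] := jP i.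
  by exists (ds_map D (jk i) y); rewrite uL.1.
have [|m mE] := extD k g; last first.
  by exists (u k m) => x xI; rewrite -gE // mE // linearZ.
move=> a x y xI yI; apply: (u_inj k).
have axyI : a * x + y \in I.
  by apply: (@rpredD R^o) => //; apply: (@rpredZ R R^o).
by rewrite linearP /= !gE ?fI.
Qed.

End DirectUnion.

(** * Extension of additive maps into divisible groups *)

Section AdditiveExtension.

Lemma int_subgroup_principal (S : set int) : S 0 ->
    (forall m n, S m -> S n -> S (m - n)) ->
  exists k : int, forall n, S n <-> (k %| n)%Z.
Proof.
move=> S0 SB.
have SN n : S n -> S (- n) by move=> /(SB _ _ S0); rewrite sub0r.
have SD m n : S m -> S n -> S (m + n).
  by move=> Sm /SN/(SB _ _ Sm); rewrite opprK.
have SM n m : S n -> S (n * m).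
  move=> Sn; elim/int_rec: m => [|m|m]; first by rewrite mulr0.
    by rewrite -addn1 PoszD mulrDr mulr1 => /SD; apply.
  by rewrite -addn1 PoszD opprD mulrDr mulrN1 => /SB; apply.
have [[n n_gt0 Sn]|noS] := pselect (exists2 n : nat, (0 < n)%N & S n).
  have ex_n : exists n : nat, (0 < n)%N && `[< S n >].
    by exists n; rewrite n_gt0; apply/asboolP.
  case: (ex_minnP ex_n) => k /andP[k_gt0 /asboolP Sk] k_min.
  exists k => m; split=> [Sm|/dvdzP[q ->]]; last by rewrite mulrC; apply: SM.
  apply/dvdz_mod0P; apply: contrapT => /eqP r_neq0.
  have Sr : S (m %% k)%Z.
    by rewrite /modz mulrC; apply: SB => //; apply: SM.
  have r_ge0 : (0 <= (m %% k)%Z)%R by rewrite modz_ge0 // -lt0n.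
  have r_lt : ((m %% k)%Z < k)%R by rewrite ltz_pmod.
  move: Sr r_neq0 r_ge0 r_lt; case: (m %% k)%Z => // r Sr r_neq0 _.
  rewrite ltz_nat ltnNge k_min // lt0n; apply/andP; split; last exact/asboolP.
  by apply: contraNneq r_neq0 => ->.
exists 0 => n; rewrite dvd0z; split=> [Sn|/eqP-> //].
apply: contrapT => /negP n_neq0; apply: noS; exists `|n|%N.
  by rewrite absz_gt0.
by case: n Sn {n_neq0} => n // /SN; rewrite NegzE opprK.
Qed.

Variables B D : zmodType.

(** Graphs of additive maps from a subgroup of B to D. *)
Definition additive_graph (G : set (B * D)) : Prop :=
  [/\ G (0, 0),
      forall p q, G p -> G q -> G (p.1 - q.1, p.2 - q.2) &
      forall d, G (0, d) -> d = 0].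

Lemma additive_graphMz G b d (n : int) :
  additive_graph G -> G (b, d) -> G (b *~ n, d *~ n).
Proof.
move=> [G0 GB _] Gbd.
have GD p q : G p -> G q -> G (p.1 + q.1, p.2 + q.2).
  move=> Gp /(GB _ _ G0)/(GB _ _ Gp) /=.
  by rewrite !sub0r !opprK.
elim/int_rec: n => [|n|n]; first by rewrite !mulr0z.
  by rewrite -addn1 PoszD !mulrzDr => /GD/(_ Gbd).
by rewrite -addn1 PoszD opprD !mulrzDr => /GB/(_ Gbd).
Qed.

(** Adjoining (b, d) to a graph is possible as soon as n d is the value already
prescribed at n b, whenever there is one. *)
Lemma additive_graph_adjoin G b d : additive_graph G ->
    (forall (n : int) e, G (b *~ n, e) -> e = d *~ n) ->
  additive_graph [set p | exists n : int, G (p.1 - b *~ n, p.2 - d *~ n)].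
Proof.
move=> [G0 GB G_fun] bd; split=> [|p q [m Gm] [n Gn]|e [n /= Gn]].
- by exists 0; rewrite !mulr0z !subrr.
- exists (m - n); have /= := GB _ _ Gm Gn.
  have subrACA (V : zmodType) (x y z t : V) : x - y - (z - t) = x - z - (y - t).
    by rewrite !opprB addrACA [RHS]addrACA [- y - z]addrC.
  by rewrite !mulrzBr subrACA [X in (_, X)]subrACA.
- have /= := GB _ _ G0 Gn; rewrite !sub0r !opprK opprB => /bd.
  by move/eqP; rewrite subr_eq addrC -subr_eq subrr eq_sym => /eqP.
Qed.

Hypothesis D_div : forall (k : int) (d : D), k != 0 -> exists e, e *~ k = d.

(** By Zorn there is a maximal graph containing [G0]. For b in B, the n such
that n b lies in its domain are the multiples of some k; by divisibility there
is d such that k d is the value at k b, so that (b, d) may be adjoined.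
Maximality puts b in the domain. *)
Lemma additive_extension G0 : additive_graph G0 ->
  exists g : B -> D,
    {morph g : x y / x + y} /\ forall b d, G0 (b, d) -> g b = d.
Proof.
move=> G0_graph.
(* Zorn's lemma also asks for an upper bound of the empty chain: hence the
   union with [G0] rather than the condition that X contains [G0]. *)
pose P X := additive_graph (G0 `|` X).
have [|X [PX X_max]] := @Zorn_bigcup _ P.
  move=> F FP F_total; have [G00 G0B G0_fun] := G0_graph.
  have two p q :
      (G0 `|` \bigcup_(X in F) X) p -> (G0 `|` \bigcup_(X in F) X) q ->
      (G0 p /\ G0 q) \/ exists X, [/\ F X, (G0 `|` X) p & (G0 `|` X) q].
    move=> [Gp|[X FX Xp]] [Gq|[Y FY Yq]].
    - by left.
    - by right; exists Y; split=> //; [left|right].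
    - by right; exists X; split=> //; [right|left].
    - right; have [XY|YX] := F_total _ _ FX FY.
        by exists Y; split=> //; right=> //; apply: XY.
      by exists X; split=> //; right=> //; apply: YX.
  split=> [|p q p_in q_in|d d_in]; first by left.
    have [[Gp Gq]|[X [FX Xp Xq]]] := two _ _ p_in q_in.
      by left; apply: G0B.
    have [_ XB _] := FP _ FX.
    by case: (XB _ _ Xp Xq) => [|?]; [left|right; exists X].
  have [[Gd _]|[X [FX Xd _]]] := two _ _ d_in d_in; first exact: G0_fun.
  by have [_ _ X_fun] := FP _ FX; apply: X_fun.
pose G := G0 `|` X; have [GO GB G_fun] : additive_graph G := PX.
have G_max G' : additive_graph G' -> G `<=` G' -> G' `<=` G.
  move=> G'_graph GG' p G'p; right; apply: contrapT => Xp.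
  apply: (X_max G').
    split; first by move=> q Xq; apply: GG'; right.
    by move=> /(_ _ G'p).
  by rewrite /P setUidr // => q G0q; apply: GG'; left.
have G_uniq b d e : G (b, d) -> G (b, e) -> d = e.
  move=> Gd /(GB _ _ Gd) /=; rewrite subrr => /G_fun/eqP.
  by rewrite subr_eq0 => /eqP.
have /choice[g gE] : forall b, exists d, G (b, d).
  move=> b.
  have [||k kE] := @int_subgroup_principal [set n | exists d, G (b *~ n, d)].
  - by exists 0; rewrite mulr0z.
  - move=> m n [d Gd] [e Ge]; exists (d - e).
    by rewrite mulrzBr; apply: (GB _ _ Gd Ge).
  have [d Gkd] : exists d, G (b *~ k, d *~ k).
    have [->|k_neq0] := eqVneq k 0; first by exists 0; rewrite !mulr0z.
    have [e Ge] := (kE k).2 (dvdzz k).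
    by have [d de] := D_div e k_neq0; exists d; rewrite de.
  exists d; have bd (n : int) e : G (b *~ n, e) -> e = d *~ n.
    move=> Ge; have /dvdzP[m n_eq] : (k %| n)%Z by apply/kE; exists e.
    apply: G_uniq Ge _; rewrite n_eq mulrC !mulrzA.
    exact: additive_graphMz.
  apply: (G_max _ (additive_graph_adjoin PX bd)).
    by move=> [b' d'] Gp; exists 0; rewrite !mulr0z !subr0.
  by exists 1; rewrite !mulr1z !subrr.
exists g; split=> [x y|b d G0bd]; last by apply: (G_uniq b) => //; left.
apply: (G_uniq (x + y)) => //.
have GN : G (- y, - g y) by have := GB _ _ GO (gE y); rewrite !sub0r.
by have := GB _ _ (gE x) GN; rewrite /= !opprK.
Qed.

End AdditiveExtension.

(** * The character module *)

(** These are the two properties of Q/Z used below: it is divisible, and the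
cyclic group Z/k, when it is not trivial, has a nonzero map to it (to the class
of 1/k, or of 1/2 if k = 0). *)
Lemma rat_mod_int : exists D : zmodType,
  (forall (k : int) (d : D), k != 0 -> exists e, e *~ k = d) /\
  (forall k : int, ~~ (k %| 1)%Z -> exists2 d : D, d != 0 & d *~ k = 0).
Proof.
pose Zpred : {pred rat} := fun r => r \is a Num.int.
have Z_closed : zmod_closed Zpred.
  split=> [|x y /intrP[m ->] /intrP[n ->]]; apply/intrP; first by exists 0.
  by exists (m - n); rewrite rmorphB.
pose Z : zmodClosed rat :=
  HB.pack Zpred (GRing.isZmodClosed.Build rat Zpred Z_closed).
pose D : zmodType := Quotient.quot Z.
pose p (r : rat) : D := \pi_(Quotient.quot Z) r.
have pD : {morph p : x y / x + y} by move=> x y; apply: Quotient.pi_add.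
have p0 : p 0 = 0 by apply: (addrI (p 0)); rewrite -pD !addr0.
have pN : {morph p : x / - x}.
  by move=> x; apply: (addrI (p x)); rewrite -pD !subrr.
have pM x (k : int) : p (x *~ k) = p x *~ k.
  elim/int_rec: k => [|k IHk|k IHk]; rewrite ?mulr0z //.
    by rewrite -addn1 PoszD !mulrzDr pD IHk.
  by rewrite -addn1 PoszD opprD !mulrzDr pD IHk !mulrN1z pN.
have p_eq0 r : p r = 0 <-> r \is a Num.int.
  rewrite -p0; have := Quotient.idealrBE Z r 0.
  rewrite subr0 -[r \in Z]/(r \is a Num.int) => ->.
  by split=> [/eqP|/eqP].
exists D; split=> [k d k_neq0|k k_unit].
  exists (p (repr d / k%:~R)); rewrite -pM -mulrzr divfK ?intr_eq0 //.
  by rewrite /p reprK.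
have [->|k_neq0] := eqVneq k 0.
  exists (p (1 / 2)); last by rewrite mulr0z.
  by apply/eqP => /p_eq0.
exists (p (k%:~R^-1)); last first.
  rewrite -pM -mulrzr mulVf ?intr_eq0 //; apply/p_eq0/intrP.
  by exists 1.
apply/eqP => /p_eq0/intrP[m km]; case/negP: k_unit; apply/dvdzP; exists m.
by apply/eqP; rewrite -(eqr_int rat) rmorphM /= -km mulVf ?intr_eq0.
Qed.

Section CharacterModule.
Variables (R : pzRingType) (D : zmodType).

(** [charmod] is Hom_Z(R, D), with the action (a f)(r) = f(r a). *)
Definition additive_fun : {pred R -> D} :=
  fun f => `[< {morph f : x y / x + y} >].

Lemma additive_fun_zmod_closed : zmod_closed additive_fun.
Proof.
split=> [|f g /asboolP fD /asboolP gD]; apply/asboolP => x y /=.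
  by rewrite addr0.
by rewrite -[LHS]/(f (x + y) - g (x + y)) fD gD opprD addrACA.
Qed.

HB.instance Definition _ :=
  GRing.isZmodClosed.Build (R -> D) additive_fun additive_fun_zmod_closed.

Record charmod : Type :=
  Charmod { charmod_val :> R -> D; _ : charmod_val \in additive_fun }.

HB.instance Definition _ := [isSub for charmod_val].
HB.instance Definition _ := [Choice of charmod by <:].
HB.instance Definition _ := [SubChoice_isSubZmodule of charmod by <:].

Lemma charmodP (f : charmod) : {morph f : x y / x + y}.
Proof. by case: f => f /= /asboolP. Qed.

Lemma charmod_scale_subproof (a : R) (f : charmod) :
  (fun r => f (r * a)) \in additive_fun.
Proof. by apply/asboolP => x y; rewrite mulrDl charmodP. Qed.

Definition charmod_scale a f := Charmod (charmod_scale_subproof a f).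

Lemma charmod_eq (f g : charmod) : f =1 g -> f = g.
Proof. by move=> fg; apply/val_inj/funext. Qed.

Lemma charmod_scalerA a b f :
  charmod_scale a (charmod_scale b f) = charmod_scale (a * b) f.
Proof. by apply: charmod_eq => r /=; rewrite mulrA. Qed.
Lemma charmod_scale1r : left_id 1 charmod_scale.
Proof. by move=> f; apply: charmod_eq => r /=; rewrite mulr1. Qed.
Lemma charmod_scalerDr : right_distributive charmod_scale +%R.
Proof. by move=> a f g; apply: charmod_eq. Qed.
Lemma charmod_scalerDl f : {morph charmod_scale^~ f : a b / a + b}.
Proof. by move=> a b; apply: charmod_eq => r; rewrite /= mulrDr charmodP. Qed.

HB.instance Definition _ := GRing.Zmodule_isLmodule.Build R charmod
  charmod_scalerA charmod_scale1r charmod_scalerDr charmod_scalerDl.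

Hypothesis D_div : forall (k : int) (d : D), k != 0 -> exists e, e *~ k = d.

(** R-linear maps A -> Hom_Z(R, D) correspond to additive maps A -> D by
evaluation at 1, so extending the former along A -> B amounts to extending the
latter. *)
Lemma charmod_injective : is_injective charmod.
Proof.
move=> A B i f i_inj.
pose G0 : set (B * D) := [set p | exists a, p = (i a, f a 1)].
have [|g0 [g0D g0E]] := @additive_extension B D D_div G0.
  split=> [|_ _ [a ->] [b ->]|d [a [ia0 ->]]].
  - by exists 0; rewrite !linear0.
  - by exists (a - b); rewrite !linearB.
  - have -> : a = 0 by apply: i_inj; rewrite linear0.
    by rewrite linear0.
have gP b : (fun r : R => g0 (r *: b)) \in additive_fun.
  by apply/asboolP => r s; rewrite scalerDl g0D.
have gL : linear (fun b => Charmod (gP b)).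
  move=> a x y; apply: charmod_eq => r /=.
  by rewrite scalerDr scalerA g0D.
exists (mklin gL) => a; apply: charmod_eq => r /=.
rewrite -linearZ (g0E _ (f (r *: a) 1)); last by exists (r *: a).
by rewrite linearZ /= mul1r.
Qed.

Hypothesis D_tors : forall k : int, ~~ (k %| 1)%Z ->
  exists2 d : D, d != 0 & d *~ k = 0.

(** In V/W the class of x generates a nontrivial cyclic group, which has a
nonzero map to D; it extends to V by divisibility. *)
Lemma character_separation (V : lmodType R) (W : submodClosed V) (x : V) :
  x \notin W -> exists chi : V -> D,
    [/\ {morph chi : y z / y + z}, forall y, y \in W -> chi y = 0 & chi x != 0].
Proof.
move=> xW; have [_ WB] := submod_zmod_closed W.
have [||k kE] := @int_subgroup_principal [set n | x *~ n \in W].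
- by rewrite /= mulr0z rpred0.
- by move=> m n /= xm xn; rewrite mulrzBr; apply: WB.
have [|d d_neq0 dk] := D_tors (k := k).
  by apply/negP => /kE; rewrite /= mulr1z; apply/negP.
pose G0 : set (V * D) := [set p | p.1 \in W /\ p.2 = 0].
have G0_graph : additive_graph G0.
  split=> [|p q [p1 p2] [q1 q2]|e [_ /=]] //; first by split; rewrite ?rpred0.
  by split; rewrite /= ?p2 ?q2 ?subrr //; apply: WB.
have xd (n : int) e : G0 (x *~ n, e) -> e = d *~ n.
  move=> [/kE/dvdzP[m ->] /= ->].
  by rewrite mulrC mulrzA dk mul0rz.
have [chi [chiD chiE]] :=
  additive_extension D_div (additive_graph_adjoin G0_graph xd).
exists chi; split=> // [y yW|].
  by apply: chiE; exists 0; rewrite /= !mulr0z !subr0.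
rewrite (chiE x d) //; exists 1; rewrite /= !mulr1z !subrr.
by split; rewrite ?rpred0.
Qed.

End CharacterModule.

(** * Injective modules *)

Section Injectives.
Variable R : pzRingType.

Lemma injective_extendable (I : submodClosed R^o) (E : lmodType R) :
  is_injective E -> extendable I E.
Proof.
move=> E_inj f fI.
have iL : linear (@subm_val R R^o I) by [].
have fL : linear (fun x : subm I => f (subm_val x)).
  by move=> a x y; rewrite /= fI ?(valP x) ?(valP y).
have [|g gE] := E_inj _ _ (mklin iL) (mklin fL); first exact: val_inj.
exists (g (1 : R^o)) => x xI; have /= <- := gE (Subm xI).
by rewrite -linearZ /= -[_ *: _]/(_ * _) mulr1.
Qed.

Lemma prodmod_injective (J : Type) (M : J -> lmodType R) :
  (forall j, is_injective (M j)) -> is_injective (prodmod M).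
Proof.
move=> M_inj A B i f i_inj.
have fL j : linear (fun a => f a j) by move=> r x y; rewrite linearP.
have g_ex j := M_inj j A B i (mklin (fL j)) i_inj.
have gL : linear (fun b => (fun j => sval (cid (g_ex j)) b) : prodmod M).
  by move=> r x y; apply: functional_extensionality_dep => j; rewrite linearP.
exists (mklin gL) => a; apply: functional_extensionality_dep => j.
exact: (svalP (cid (g_ex j)) a).
Qed.

Lemma retract_injective (E M : lmodType R) (s : {linear M -> E})
    (r : {linear E -> M}) : cancel s r -> is_injective E -> is_injective M.
Proof.
move=> sK E_inj A B i f i_inj.
have sfL : linear (fun a => s (f a)) by move=> c x y; rewrite !linearP.
have [g gE] := E_inj A B i (mklin sfL) i_inj.
have rgL : linear (fun b => r (g b)) by move=> c x y; rewrite !linearP.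
by exists (mklin rgL) => a; rewrite /= gE /= sK.
Qed.

End Injectives.

(** * Direct sums of injectives as direct unions of injectives *)

Section UnionOfSubmodules.
Variables (R : pzRingType) (L : lmodType R) (K : Type) (le : K -> K -> Prop).
Variable W : K -> submodClosed L.
Hypothesis le_dir : directed le.
Hypothesis W_mono : forall i j, le i j -> {subset W i <= W j}.
Hypothesis W_cover : forall x, exists i, x \in W i.

Definition subm_incl i j (ij : le i j) (x : subm (W i)) : subm (W j) :=
  Subm (W_mono ij (valP x)).

Lemma subm_incl_linear i j (ij : le i j) : linear (subm_incl ij).
Proof. by move=> a x y; apply: val_inj. Qed.

Lemma subm_incl_id i (ii : le i i) x : mklin (subm_incl_linear ii) x = x.
Proof. exact: val_inj. Qed.

Lemma subm_incl_comp i j k (ij : le i j) (jk : le j k) (ik : le i k) x :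
  mklin (subm_incl_linear jk) (mklin (subm_incl_linear ij) x) =
  mklin (subm_incl_linear ik) x.
Proof. exact: val_inj. Qed.

Definition subm_system : direct_system R le :=
  @DirectSystem R K le (fun i => subm (W i))
    (fun i j ij => mklin (subm_incl_linear ij)) subm_incl_id subm_incl_comp.

(** The map induced by a cocone is v_i on W_i; this is consistent because any
two members lie in a third one. *)
Lemma subm_system_union : is_direct_union subm_system L.
Proof.
have [_ _ _ le_bound] := le_dir.
have uL i : linear (@subm_val R L (W i)) by [].
split=> // [i j ij x y /(congr1 (@subm_val _ _ _)) xy|]; first exact: val_inj.
exists (fun i => mklin (uL i)); split=> // T v vC.
have v_uniq i j (x : subm (W i)) (y : subm (W j)) :
    subm_val x = subm_val y -> v i x = v j y.
  move=> xy; have [k ik jk] := le_bound i j.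
  by rewrite -(vC _ _ ik) -(vC _ _ jk); congr (v k _); apply: val_inj.
have /choice[h hE] : forall x : L, exists t, forall i (xi : x \in W i),
    t = v i (Subm xi).
  move=> x; have [i xi] := W_cover x.
  by exists (v i (Subm xi)) => j xj; apply: v_uniq.
have hL : linear h.
  move=> a x y; have [i xi] := W_cover x; have [j yj] := W_cover y.
  have [k ik jk] := le_bound i j.
  have xk := W_mono ik xi; have yk := W_mono jk yj.
  have axyk : a *: x + y \in W k by rewrite rpredD ?rpredZ.
  rewrite (hE _ _ xk) (hE _ _ yk) (hE _ _ axyk) -linearP.
  by congr (v k _); apply: val_inj.
exists (mklin hL); split=> [j [x xj]|h' h'E y] /=; first exact: hE.
by have [i yi] := W_cover y; rewrite (hE _ _ yi) -h'E.
Qed.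

End UnionOfSubmodules.

Section DirectSumUnion.
Variables (R : pzRingType) (J : Type) (M : J -> lmodType R).

Definition finite_subset : Type := {F : set J | finite_set F}.

Definition finite_subset_le (F G : finite_subset) : Prop := sval F `<=` sval G.

Lemma finite_subset_directed : directed finite_subset_le.
Proof.
split=> [|F|F G H|F G] //.
- exact: (inhabits (exist _ set0 (finite_set0 J))).
- by move=> FG GH j /FG/GH.
have FG : finite_set (sval F `|` sval G).
  by rewrite finite_setU; split; apply: svalP.
by exists (exist _ _ FG) => j Fj; [left|right].
Qed.

(** The members are the submodules of the elements supported in a finite set F.
Restriction to F retracts the full product, which is injective, onto it. *)
Lemma dsum_injective_union : (forall j, is_injective (M j)) ->
  exists D : direct_system R finite_subset_le,
    is_direct_union D (dsum M) /\ forall F, is_injective (D F).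
Proof.
move=> M_inj.
have /choice[W WE] : forall F : finite_subset, exists W : submodClosed (dsum M),
    forall f, f \in W <-> forall j, ~ sval F j -> dsum_val f j = 0.
  move=> F; apply: submod_of_prop => // a f g f0 g0 j Fj.
  by rewrite -[LHS]/(a *: dsum_val f j + dsum_val g j) f0 ?g0 // scaler0 addr0.
have W_mono F G : finite_subset_le F G -> {subset W F <= W G}.
  by move=> FG f /WE f0; apply/WE => j Gj; apply: f0 => /FG.
have W_cover f : exists F, f \in W F.
  have f_fin : finite_set [set j | dsum_val f j != 0].
    by case: f => f /= /asboolP.
  exists (exist _ _ f_fin); apply/WE => j /= /negP; rewrite negbK.
  by move/eqP.
exists (subm_system W_mono); split.
  exact: (subm_system_union finite_subset_directed W_mono W_cover).
move=> F.
pose res (f : prodmod M) : prodmod M :=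
  fun j => if pselect (sval F j) then f j else 0.
have resP f : res f \in @fin_supp R J M.
  apply/asboolP; apply: (sub_finite_set _ (svalP F)) => j /= /eqP.
  by apply: contra_notP => Fj; rewrite /res; case: pselect.
have resW f : DSum (resP f) \in W F.
  by apply/WE => j Fj; rewrite /= /res; case: pselect.
have rL : linear (fun f => Subm (resW f)).
  move=> a f g; apply/val_inj/val_inj/functional_extensionality_dep => j.
  rewrite -[RHS]/(a *: res f j + res g j) /= /res.
  by case: pselect => //= Fj; rewrite scaler0 addr0.
have sL : linear (fun f : subm (W F) => dsum_val (subm_val f)) by [].
apply: (@retract_injective R _ _ (mklin sL) (mklin rL)).
  move=> f; apply/val_inj/val_inj/functional_extensionality_dep => j /=.
  rewrite /res; case: pselect => //= Fj.
  by have /WE -> := valP f.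
exact: prodmod_injective.
Qed.

End DirectSumUnion.

(** * The argument of Bass *)

Section Bass.
Variables (R : pzRingType) (D : zmodType).
Hypothesis D_div : forall (k : int) (d : D), k != 0 -> exists e, e *~ k = d.
Hypothesis D_tors : forall k : int, ~~ (k %| 1)%Z ->
  exists2 d : D, d != 0 & d *~ k = 0.

(** The hypothesis says that I is generated by the x i with i < n, phrased
through all submodules containing them; linear combinations are one such
submodule. *)
Lemma fin_gen_of_prefix (I : submodClosed R^o) (n : nat) (x : nat -> R) :
    (forall i, (i < n)%N -> x i \in I) ->
    (forall y : R, y \in I -> forall W : submodClosed R^o,
       (forall i, (i < n)%N -> x i \in W) -> y \in W) ->
  fin_gen I.
Proof.
move=> xI I_span; exists n, (fun i => x i) => y.
have [||W WE] := @submod_of_prop R R^o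
  [set y | exists c : 'I_n -> R, y = \sum_(i < n) c i *: (x i : R^o)].
- by exists (fun=> 0); rewrite big1 // => i _; rewrite scale0r.
- move=> a _ _ [c ->] [d ->]; exists (fun i => a * c i + d i).
  rewrite scaler_sumr -big_split; apply: eq_bigr => i _ /=.
  by rewrite scalerA -scalerDl.
split=> [yI|[c ->]].
  apply/WE/I_span => // i i_n; apply/WE.
  exists (fun j => (j == Ordinal i_n)%:R).
  rewrite (bigD1 (Ordinal i_n)) //= eqxx scale1r big1 ?addr0 // => j /negPf ->.
  by rewrite scale0r.
by apply: rpred_sum => i _; rewrite rpredZ ?xI.
Qed.

(** No finite list of elements of I generates I, so the list can always be
prolonged by an element of I outside its span. W n is the span of the first n
elements. *)
Lemma ascending_chain (I : submodClosed R^o) : ~ fin_gen I ->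
  exists (x : nat -> R) (W : nat -> submodClosed R^o),
    [/\ forall n, {subset W n <= I},
        forall n m, (n <= m)%N -> {subset W n <= W m},
        forall n, x n \in W n.+1 &
        forall n, x n \notin W n].
Proof.
move=> I_nfg.
(* Membership in the span, as membership in every submodule containing the
   generators: monotonicity and closure are then immediate. *)
pose spans (n : nat) (x : nat -> R) (y : R) := forall W : submodClosed R^o,
  (forall i, (i < n)%N -> x i \in W) -> y \in W.
have /choice[pick pickP] : forall s : seq R, exists y : R,
    (forall i, (i < size s)%N -> s`_i \in I) ->
    y \in I /\ ~ spans (size s) (nth 0 s) y.
  move=> s; apply: contrapT => noy; apply: I_nfg.
  apply: (@fin_gen_of_prefix I (size s) (nth 0 s)).
    by move=> i i_s; apply: contrapT => si; apply: noy; exists 0 => /(_ i i_s).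
  move=> y yI; apply: contrapT => ny; apply: noy; exists y => _; split=> //.
pose st n := iter n (fun s => rcons s (pick s)) [::].
pose x n := pick (st n).
have stE n : st n = mkseq x n.
  by elim: n => // n IHn; rewrite mkseqS -IHn.
have spansE n y : spans (size (st n)) (nth 0 (st n)) y <-> spans n x y.
  rewrite stE size_mkseq; split=> s W xW; apply: s => i i_n.
    by rewrite nth_mkseq // xW.
  by rewrite -(nth_mkseq 0 x i_n) xW.
have xP n : x n \in I /\ ~ spans n x (x n).
  elim/ltn_ind: n => n IHn; rewrite -spansE; apply: pickP => i.
  by rewrite stE size_mkseq => i_n; rewrite nth_mkseq //; case: (IHn i i_n).
have /choice[W WE] : forall n, exists W : submodClosed R^o,
    forall y, y \in W <-> spans n x y.
  move=> n; apply: submod_of_prop => [W _|a y z ys zs W xW].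
    exact: rpred0.
  by apply: (@rpredD R^o); [apply: (@rpredZ R R^o); apply: ys|apply: zs].
exists x, W; split=> [n y /WE|n m nm y /WE ys|n|n].
- by apply=> i _; case: (xP i).
- by apply/WE => V xV; apply: ys => i i_n; apply: xV; apply: leq_trans nm.
- by apply/WE => V; apply.
- by apply/negP => /WE; case: (xP n).
Qed.

(** The conclusion concerns I, but the map that fails to extend is defined only
on the union I' of a chain inside I: hence the hypothesis on all ideals
contained in I. *)
Lemma fin_gen_of_dsum_extendable (I : submodClosed R^o) :
    (forall I' : submodClosed R^o, {subset I' <= I} ->
       extendable I' (dsum (fun _ : nat => charmod R D : lmodType R))) ->
  fin_gen I.
Proof.
move=> ext; apply: contrapT => /ascending_chain[x [W [WI W_mono xW xNW]]].
have [||I' I'E] := @submod_of_prop R R^o [set y | exists n, y \in W n].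
- by exists 0; apply: rpred0.
- move=> a y z [n yn] [m zm]; exists (maxn n m).
  rewrite rpredD ?rpredZ //.
    exact: W_mono (leq_maxl _ _) _ yn.
  exact: W_mono (leq_maxr _ _) _ zm.
have /choice[chi chiP] : forall n, exists c : R -> D,
    [/\ {morph c : y z / y + z}, forall y : R, y \in W n -> c y = 0
      & c (x n) != 0].
  by move=> n; apply: (character_separation D_div D_tors (xNW n)).
have chi_add n : chi n \in @additive_fun R D.
  by apply/asboolP; case: (chiP n).
pose C (_ : nat) : lmodType R := charmod R D.
(* The family (chi_n)_n lies in the product only, but its multiples by
   elements of I' have finite support. *)
pose X : prodmod C := fun n => Charmod (chi_add n).
have /choice[f fE] : forall y : R, exists f : dsum C,
    y \in I' -> dsum_val f = y *: X.
  move=> y; have [/I'E[k yk]|] := boolP ((y : R^o) \in I'); last by exists 0.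
  have yX : y *: X \in @fin_supp R nat C.
    apply/asboolP; apply: (sub_finite_set _ (finite_II k)) => n /=.
    apply: contra_neqT; rewrite -leqNgt => kn.
    apply: charmod_eq => r; have [_ chi0 _] := chiP n.
    by apply: (chi0 (r * y)); apply: (@rpredZ R R^o); apply: W_mono yk.
  by exists (DSum yX).
have [||m mE] := ext I' _ f.
- by move=> y /I'E[n yn]; apply: WI yn.
- move=> a y z yI zI; apply: val_inj => /=.
  have ayzI : a * y + z \in I'.
    by apply: (@rpredD R^o) => //; apply: (@rpredZ R R^o).
  rewrite -[RHS]/(a *: dsum_val (f y) + dsum_val (f z)) !fE //.
  by rewrite scalerDl scalerA.
have [N mN] : exists N, dsum_val m N = 0.
  apply: contrapT => mN; apply: infinite_nat.
  have m_fin : finite_set [set n | dsum_val m n != 0].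
    by case: {+}m => g /= /asboolP.
  apply: sub_finite_set m_fin => n _ /=.
  by apply/eqP => mn; apply: mN; exists n.
have xI' : x N \in I' by apply/I'E; exists N.+1.
have /(congr1 (fun g => dsum_val g N)) := mE _ xI'.
rewrite fE // -[RHS]/(x N *: dsum_val m N) mN scaler0.
move=> /(congr1 (fun h : charmod R D => h 1)) xN0.
have [_ _ /eqP[]] := chiP N.
by rewrite -[RHS]xN0 -[x N in LHS]mul1r.
Qed.

End Bass.

(** * The equivalences *)

Lemma nil_injectiveP (R : comPzRingType) (M : lmodType R) :
  Nil_injective M <-> forall I, nil_ideal I -> extendable I M.
Proof.
by split=> H I /H; [apply: Ext1_extendable|apply: extendable_Ext1].
Qed.

Theorem theorem3p5 (R : comPzRingType) :
  [<-> Nil_Noetherian R;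
       forall (J : Type) (M : J -> lmodType R),
         (forall j, Nil_injective (M j)) -> Nil_injective (dsum M);
       forall (J : Type) (M : J -> lmodType R),
         (forall j, is_injective (M j)) -> Nil_injective (dsum M);
       forall (J : Type) (le : J -> J -> Prop) (D : direct_system R le)
              (L : lmodType R),
         is_direct_union D L ->
         (forall j, Nil_injective (D j)) -> Nil_injective L;
       forall (J : Type) (le : J -> J -> Prop) (D : direct_system R le)
              (L : lmodType R),
         is_direct_union D L ->
         (forall j, is_injective (D j)) -> Nil_injective L;
       forall M : lmodType R, Nil_FP_injective M -> Nil_injective M].
Proof.
have injective_nil (M : lmodType R) : is_injective M -> Nil_injective M.
  by move=> M_inj; apply/nil_injectiveP => I _; apply: injective_extendable.
have sums_noetherian :
    (forall (J : Type) (M : J -> lmodType R),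
       (forall j, is_injective (M j)) -> Nil_injective (dsum M)) ->
  Nil_Noetherian R.
  move=> sums I I_nil; have [D [D_div D_tors]] := rat_mod_int.
  apply: (fin_gen_of_dsum_extendable D_div D_tors) => I' I'I.
  apply: (nil_injectiveP _).1; last by move=> x /I'I; apply: I_nil.
  by apply: sums => _; apply: charmod_injective.
have unions_sums :
    (forall (J : Type) (le : J -> J -> Prop) (D : direct_system R le)
            (L : lmodType R), is_direct_union D L ->
       (forall j, is_injective (D j)) -> Nil_injective L) ->
  forall (J : Type) (M : J -> lmodType R),
    (forall j, is_injective (M j)) -> Nil_injective (dsum M).
  move=> unions J M M_inj; have [D [DM D_inj]] := dsum_injective_union M_inj.
  exact: unions DM D_inj.
tfae.
- move=> noeth J M M_inj; apply/nil_injectiveP => I I_nil.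
  apply: dsum_extendable; first exact: noeth.
  by move=> j; apply: (nil_injectiveP _).1.
- by move=> sums J M M_inj; apply: sums => j; apply: injective_nil.
- move=> /sums_noetherian noeth J le D L DL D_inj.
  apply/nil_injectiveP => I I_nil.
  apply: (direct_union_extendable (noeth _ I_nil) DL) => j.
  exact: (nil_injectiveP _).1.
- move=> unions J le D L DL D_inj; apply: (unions _ _ _ _ DL) => j.
  exact: injective_nil.
- by move=> /unions_sums/sums_noetherian noeth M M_fp I I_nil; apply/M_fp/noeth.
- move=> fp; apply: sums_noetherian => J M M_inj; apply: fp => I I_nil I_fg.
  by apply/extendable_Ext1/dsum_extendable => // j; apply: injective_extendable.
Qed.
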